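(* Let $X_1,\ldots,X_n$ be $\{0,1\}$-valued random variables satisfying negative regression. Let $f:\{0,1\}^n \to \mathbb{R}$ be $1$-Lipschitz, and let $\mu = \mathbb{E}[f(X_1,\ldots,X_n)]$. Then for every $t>0$, $$\Pr[f(X_1,\ldots,X_n) \ge \mu + t] \le e^{-t^2/(2n)}, \qquad \Pr[f(X_1,\ldots,X_n) \le \mu - t] \le e^{-t^2/(2n)}.$$ If moreover $f$ is monotone (non-decreasing in each coordinate), both bounds improve to $e^{-2t^2/n}$.
   Context: For $S\subseteq[n]$, $X_S\in\{0,1\}^S$ denotes the tuple $(X_i)_{i\in S}$. The variables $X_1,\ldots,X_n$ satisfy negative regression if for all disjoint $I,J\subseteq[n]$, every non-decreasing function $g:\{0,1\}^I\to\mathbb{R}$, and all $a\le b$ in $\{0,1\}^J$ (coordinatewise) such that $\Pr[X_J=a]>0$ and $\Pr[X_J=b]>0$, we have $\mathbb{E}[g(X_I)\mid X_J=a]\ge \mathbb{E}[g(X_I)\mid X_J=b]$. A function $f:\{0,1\}^n\to\mathbb{R}$ is $1$-Lipschitz if changing any single coordinate of its argument changes its value by at most $1$ in absolute value. *)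

(* Defs.v *)
From HB Require Import structures.
From mathcomp Require Import all_boot.
From Stdlib Require Import Reals.
Set Implicit Arguments. Unset Strict Implicit. Unset Printing Implicit Defensive.

Open Scope R_scope.

Lemma Rplus_0_l' : left_id 0 Rplus. Proof. exact: Rplus_0_l. Qed.
Lemma Rplus_0_r' : right_id 0 Rplus. Proof. exact: Rplus_0_r. Qed.
HB.instance Definition _ := Monoid.isComLaw.Build R 0 Rplus
  (fun a b c => esym (Rplus_assoc a b c)) Rplus_comm Rplus_0_l'.

Definition cube (n : nat) := {ffun 'I_n -> bool}.

(* A probability distribution (law of (X_1,...,X_n)) on the cube. *)
Definition is_distribution n (p : cube n -> R) : Prop :=
  (forall x, 0 <= p x) /\ \big[Rplus/0]_(x : cube n) p x = 1.

Definition Pr n (p : cube n -> R) (A : pred (cube n)) : R :=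
  \big[Rplus/0]_(x : cube n | A x) p x.

Definition Expect n (p : cube n -> R) (g : cube n -> R) : R :=
  \big[Rplus/0]_(x : cube n) (p x * g x).

Definition CondExpect n (p : cube n -> R) (g : cube n -> R) (A : pred (cube n)) : R :=
  (\big[Rplus/0]_(x : cube n | A x) (p x * g x)) / Pr p A.

(* The event X_J = a (a only matters on J). *)
Definition agree_on n (J : {set 'I_n}) (a : cube n) : pred (cube n) :=
  fun x => [forall i in J, x i == a i].

(* A function g : {0,1}^I -> R, encoded as a function on the cube depending
   only on the coordinates in I. *)
Definition depends_only_on n (I : {set 'I_n}) (g : cube n -> R) : Prop :=
  forall x y : cube n, (forall i, i \in I -> x i = y i) -> g x = g y.

Definition nondecreasing_on n (I : {set 'I_n}) (g : cube n -> R) : Prop :=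
  forall x y : cube n, (forall i, i \in I -> x i ==> y i) -> g x <= g y.

Definition negative_regression n (p : cube n -> R) : Prop :=
  forall (I J : {set 'I_n}), [disjoint I & J] ->
  forall g : cube n -> R, depends_only_on I g -> nondecreasing_on I g ->
  forall a b : cube n, (forall i, i \in J -> a i ==> b i) ->
  0 < Pr p (agree_on J a) -> 0 < Pr p (agree_on J b) ->
  CondExpect p g (agree_on J a) >= CondExpect p g (agree_on J b).

Definition lipschitz1 n (f : cube n -> R) : Prop :=
  forall (j : 'I_n) (x y : cube n), (forall i, i != j -> x i = y i) ->
  Rabs (f x - f y) <= 1.

Definition monotone n (f : cube n -> R) : Prop :=
  forall x y : cube n, (forall i, x i ==> y i) -> f x <= f y.

Definition Rleb (a b : R) : bool := if Rle_dec a b then true else false.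

(* Main.v *)
(** Reveal the coordinates one at a time in an adaptive order and bound the
    increments of the resulting Doob martingale.  Given the revealed values,
    let [S] be the sum of the unrevealed coordinates.  The covariances
    [Cov(X_i, S)] add up to [Var S >= 0], so some unrevealed [i] has
    [E[S | X_i = 1] >= E[S | X_i = 0]]; reveal that one.  If [S'] is [S] without
    [X_i], this says [E[S' | X_i = 0] - E[S' | X_i = 1] <= 1].  As [f] is
    1-Lipschitz, both [S' + f] and [S' - f], with [X_i] frozen, are
    non-decreasing, so negative regression bounds the effect of [X_i] on the
    conditional mean of the frozen [f] by 1, and unfreezing costs at most 1 more.
    For monotone [f] the two effects have opposite signs and the total is at
    most 1.  Hoeffding's lemma and Chernoff's bound conclude. *)
Require Import Defs.
From HB Require Import structures.
From mathcomp Require Import all_boot.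
From Stdlib Require Import Reals Lra.
From Coquelicot Require Import Coquelicot.
Set Implicit Arguments. Unset Strict Implicit. Unset Printing Implicit Defensive.
Open Scope R_scope.

Lemma exp_le_compat (x y : R) : x <= y -> exp x <= exp y.
Proof. by case=> [lt|->]; [apply/Rlt_le/exp_increasing | apply: Rle_refl]. Qed.

Lemma hoeffding_two_point (q h : R) : 0 <= q <= 1 ->
  (1 - q) * exp (- (q * h)) + q * exp ((1 - q) * h) <= exp (h ^ 2 / 8).
Proof.
move=> q01.
pose D x := 1 - q + q * exp x.
have Dpos x : 0 < D x.
  rewrite /D; have := exp_pos x => ex.
  case: (Rle_lt_dec q (1/2)) => ?; nra.
pose L x := x ^ 2 / 8 + q * x - ln (D x).
pose L1 x := x / 4 + q - q * exp x / D x.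
pose L2 x := / 4 - (q * exp x / D x) * (1 - q * exp x / D x).
have dL x : is_derive L x (L1 x).
  rewrite /L /L1; have := Dpos x; rewrite /D => Dx.
  by auto_derive; [|field; lra].
have dL1 x : is_derive L1 x (L2 x).
  rewrite /L2 /L1; have := Dpos x; rewrite /D => Dx.
  by auto_derive; [lra|field; lra].
have L2_ge0 x : 0 <= L2 x.
  by rewrite /L2; have := pow2_ge_0 (q * exp x / D x - 1/2); lra.
have D0 : D 0 = 1 by rewrite /D exp_0; ring.
have L_0 : L 0 = 0 by rewrite /L D0 ln_1; lra.
have L1_0 : L1 0 = 0 by rewrite /L1 D0 exp_0; lra.
have contL x : continuity_pt L x.
  by apply/continuity_pt_filterlim/ex_derive_continuous; exists (L1 x).
have contL1 x : continuity_pt L1 x.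
  by apply/continuity_pt_filterlim/ex_derive_continuous; exists (L2 x).
have [c [c_between Lc]] := MVT_gen L 0 h L1 (fun x _ => dL x) (fun x _ => contL x).
have [d [_ L1d]] := MVT_gen L1 0 c L2 (fun x _ => dL1 x) (fun x _ => contL1 x).
have ch_ge0 : 0 <= c * h.
  move: c_between; rewrite /Rmin /Rmax; case: Rle_dec => ? ?; nra.
have L_ge0 : 0 <= L h.
  have -> : L h = L2 d * (c * h).
    have -> : L h = L1 c * h by lra.
    have -> : L1 c = L2 d * c by lra.
    ring.
  by apply: Rmult_le_pos.
have -> : (1 - q) * exp (- (q * h)) + q * exp ((1 - q) * h) = exp (ln (D h) - q * h).
  rewrite /Rminus exp_plus exp_ln // /D.
  have -> : (1 + - q) * h = h + - (q * h) by ring.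
  rewrite exp_plus; ring.
apply: exp_le_compat; move: L_ge0; rewrite /L; lra.
Qed.

Section Sums.
Variables (I : finType) (A : pred I).
Implicit Types F G : I -> R.

Lemma Rsum_scale c F :
  \big[Rplus/0]_(i | A i) (c * F i) = c * \big[Rplus/0]_(i | A i) F i.
Proof.
apply: esym; apply: (big_morph (fun x => c * x)).
- by move=> x y; ring.
- by ring.
Qed.

Lemma Rsum_ge0 F : (forall i, A i -> 0 <= F i) -> 0 <= \big[Rplus/0]_(i | A i) F i.
Proof.
by move=> F0; apply: (big_ind (fun x => 0 <= x)) => //; [lra | move=> x y; lra].
Qed.

Lemma Rsum_le F G : (forall i, A i -> F i <= G i) ->
  \big[Rplus/0]_(i | A i) F i <= \big[Rplus/0]_(i | A i) G i.
Proof.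
by move=> FG; apply: (big_ind2 (fun x y => x <= y)) => //; [lra | move=> *; lra].
Qed.

End Sums.

Section SumSigns.
Variables (I : finType) (A : pred I).
Implicit Types F : I -> R.

Lemma Rsum_eq0 F : (forall i, 0 <= F i) -> \big[Rplus/0]_(i | A i) F i = 0 ->
  forall i, A i -> F i = 0.
Proof.
move=> F0 S0 i Ai; move: S0; rewrite (bigD1 i) //=.
have := F0 i.
have : 0 <= \big[Rplus/0]_(j | A j && (j != i)) F j by apply: Rsum_ge0.
lra.
Qed.

Lemma Rsum_ge0_exists F : (exists i, A i) -> 0 <= \big[Rplus/0]_(i | A i) F i ->
  exists2 i, A i & 0 <= F i.
Proof.
move=> [i0 Ai0] S0.
case: (Rle_lt_dec 0 (F i0)) => [|Fi0]; first by exists i0.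
case: (pickP (fun i => A i && Rleb 0 (F i))) => [i /andP[Ai]|none].
  by rewrite /Rleb; case: Rle_dec => // Fi _; exists i.
exfalso; move: S0; rewrite (bigD1 i0) //=.
suff : \big[Rplus/0]_(i | A i && (i != i0)) F i <= 0 by lra.
apply: (big_ind (fun x => x <= 0)); [lra | by move=> *; lra |].
move=> i /andP[Ai _]; have := none i; rewrite Ai /Rleb /=.
by case: Rle_dec => // Fi _; lra.
Qed.

End SumSigns.

Section ConditionalExpectation.
Variables (n : nat) (p : cube n -> R).
Hypothesis p_ge0 : forall x, 0 <= p x.
Implicit Types (A B : pred (cube n)) (g h : cube n -> R).

Lemma Pr_ge0 A : 0 <= Pr p A.
Proof. exact: Rsum_ge0. Qed.

Lemma CondExpectD A g h :
  CondExpect p (fun x => g x + h x) A = CondExpect p g A + CondExpect p h A.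
Proof.
rewrite /CondExpect -Rdiv_plus_distr -big_split /=; congr (_ / _).
by apply: eq_bigr => x _; ring.
Qed.

Lemma CondExpectZ A c g :
  CondExpect p (fun x => c * g x) A = c * CondExpect p g A.
Proof.
rewrite /CondExpect /Rdiv -Rmult_assoc -Rsum_scale; congr (_ * _).
by apply: eq_bigr => x _; ring.
Qed.

Lemma CondExpect_cst A c : 0 < Pr p A -> CondExpect p (fun=> c) A = c.
Proof.
move=> PA; rewrite /CondExpect.
under eq_bigr do rewrite Rmult_comm.
rewrite Rsum_scale -/(Pr p A); field; lra.
Qed.

Lemma CondExpect_ext A g h : (forall x, A x -> g x = h x) ->
  CondExpect p g A = CondExpect p h A.
Proof.
by move=> gh; rewrite /CondExpect; congr (_ / _); apply: eq_bigr => x /gh ->.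
Qed.

Lemma CondExpect_le A g h : 0 < Pr p A -> (forall x, A x -> g x <= h x) ->
  CondExpect p g A <= CondExpect p h A.
Proof.
move=> PA gh; rewrite /CondExpect /Rdiv; apply: Rmult_le_compat_r.
  by apply/Rlt_le/Rinv_0_lt_compat.
by apply: Rsum_le => x /gh; apply: Rmult_le_compat_l.
Qed.

Lemma CondExpect_sum A (I : finType) (K : pred I) (F : I -> cube n -> R) :
  CondExpect p (fun x => \big[Rplus/0]_(i | K i) F i x) A =
  \big[Rplus/0]_(i | K i) CondExpect p (F i) A.
Proof.
rewrite /CondExpect.
rewrite (eq_bigr (fun x => \big[Rplus/0]_(i | K i) (p x * F i x))); last first.
  by move=> x _; rewrite Rsum_scale.
rewrite exchange_big /= /Rdiv Rmult_comm -Rsum_scale.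
by apply: eq_bigr => i _; rewrite Rmult_comm.
Qed.

Lemma Pr_split A B :
  Pr p A = Pr p (fun x => A x && ~~ B x) + Pr p (fun x => A x && B x).
Proof. by rewrite /Pr (bigID B) /= Rplus_comm. Qed.

Lemma CondExpect_mulPr A g :
  Pr p A * CondExpect p g A = \big[Rplus/0]_(x | A x) (p x * g x).
Proof.
case: (Req_dec (Pr p A) 0) => [PA0|PAn0]; last first.
  by rewrite /CondExpect /Rdiv Rmult_comm Rmult_assoc Rinv_l // Rmult_1_r.
have px0 x : A x -> p x = 0.
  by apply: Rsum_eq0.
rewrite PA0 Rmult_0_l; apply: esym; apply: big1 => x /px0 ->; ring.
Qed.

Lemma CondExpect_split A B g :
  Pr p A * CondExpect p g A =
  Pr p (fun x => A x && ~~ B x) * CondExpect p g (fun x => A x && ~~ B x) +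
  Pr p (fun x => A x && B x) * CondExpect p g (fun x => A x && B x).
Proof. by rewrite !CondExpect_mulPr (bigID B) /= Rplus_comm. Qed.

Lemma CondExpect_sqr_ge A g : 0 < Pr p A ->
  0 <= CondExpect p (fun x => g x * g x) A - CondExpect p g A * CondExpect p g A.
Proof.
move=> PA; set m := CondExpect p g A.
have : CondExpect p (fun=> 0) A <= CondExpect p (fun x => (g x - m) ^ 2) A.
  by apply: CondExpect_le => // x _; apply: pow2_ge_0.
rewrite CondExpect_cst //.
rewrite (@CondExpect_ext _ _ (fun x => g x * g x + ((-2 * m) * g x + m * m))).
  by rewrite !CondExpectD CondExpectZ CondExpect_cst // -/m; lra.
by move=> x _; ring.
Qed.

End ConditionalExpectation.

Definition ind (b : bool) : R := if b then 1 else 0.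

Definition weight n (K : {set 'I_n}) (x : cube n) : R :=
  \big[Rplus/0]_(i in K) ind (x i).

Definition set_coord n (a : cube n) (i : 'I_n) (b : bool) : cube n :=
  [ffun j => if j == i then b else a j].

Lemma agree_on_set_coord n (J : {set 'I_n}) (a : cube n) (i : 'I_n) (b : bool) :
  i \notin J ->
  agree_on (i |: J) (set_coord a i b) =1 (fun x => agree_on J a x && (x i == b)).
Proof.
move=> iJ x; apply/forall_inP/andP => [H|[/forall_inP H /eqP xi] j].
  split; last by have := H i (setU11 _ _); rewrite ffunE eqxx.
  apply/forall_inP => j jJ; have := H j (setU1r _ jJ).
  by rewrite ffunE; case: (j =P i) => // ji; rewrite -ji jJ in iJ.
rewrite in_setU1 ffunE; case: (j =P i) => [-> _|_ /= /H //].
by rewrite xi.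
Qed.

(* The covariances of the coordinates in [K] with their sum add up to a variance. *)
Lemma exists_nonneg_covariance n (p : cube n -> R) (A : pred (cube n)) (K : {set 'I_n}) :
  (forall x, 0 <= p x) -> 0 < Pr p A -> K != set0 ->
  exists2 i, i \in K &
    CondExpect p (fun x => ind (x i)) A * CondExpect p (weight K) A <=
    CondExpect p (fun x => ind (x i) * weight K x) A.
Proof.
move=> p0 PA /set0Pn K0.
pose F i := CondExpect p (fun x => ind (x i) * weight K x) A +
  (- CondExpect p (weight K) A) * CondExpect p (fun x => ind (x i)) A.
suff : 0 <= \big[Rplus/0]_(i in K) F i.
  by case/(Rsum_ge0_exists K0) => i iK Fi; exists i => //; rewrite /F in Fi; lra.
rewrite /F big_split /= Rsum_scale -!CondExpect_sum.
rewrite (@CondExpect_ext _ _ _ _ (fun x => weight K x * weight K x)).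
  have := CondExpect_sqr_ge p0 (weight K) PA.
  by rewrite -/(weight K); rewrite /weight; lra.
move=> x _; rewrite -Rsum_scale; apply: eq_bigr => i _; ring.
Qed.

Lemma lipschitz_weight n (f : cube n -> R) (s : seq 'I_n) (x y : cube n) :
  lipschitz1 f -> (forall i, i \notin s -> x i = y i) -> (forall i, x i ==> y i) ->
  Rabs (f x - f y) <= \big[Rplus/0]_(i <- s) (ind (y i) + -1 * ind (x i)).
Proof.
move=> Lf; elim: s x => [|i s IH] x xy le_xy.
  have -> : x = y by apply/ffunP => i; apply: xy.
  by rewrite big_nil Rminus_diag Rabs_R0; lra.
pose z := set_coord x i (y i).
have zy j : j \notin s -> z j = y j.
  rewrite ffunE; case: eqP => [-> //|/eqP ji js].
  by apply: xy; rewrite in_cons negb_or ji.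
have le_zy j : z j ==> y j.
  by rewrite ffunE; case: eqP => [->|_]; [apply: implybb | apply: le_xy].
have le_xz j : ind (x j) <= ind (z j).
  rewrite ffunE; case: eqP => [->|_]; last lra.
  by have := le_xy i; case: (x i) (y i) => [] [] //= _; rewrite /ind; lra.
rewrite big_cons.
have step : Rabs (f x - f z) <= ind (y i) + -1 * ind (x i).
  case: (eqVneq (x i) (y i)) => [e|ne].
    have -> : z = x by apply/ffunP => j; rewrite ffunE; case: eqP => [->|//].
    by rewrite e Rminus_diag Rabs_R0; lra.
  have -> : ind (y i) + -1 * ind (x i) = 1.
    by move: ne (le_xy i); case: (x i) (y i) => [] [] //= _ _; rewrite /ind; lra.
  by apply: (Lf i) => j ji; rewrite ffunE (negbTE ji).
have := IH z zy le_zy.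
have : \big[Rplus/0]_(j <- s) (ind (y j) + -1 * ind (z j)) <=
       \big[Rplus/0]_(j <- s) (ind (y j) + -1 * ind (x j)).
  apply: (big_ind2 (fun u v => u <= v)); [lra | by move=> *; lra |].
  by move=> j _; have := le_xz j; lra.
have := Rabs_triang (f x - f z) (f z - f y).
have -> : f x - f z + (f z - f y) = f x - f y by ring.
lra.
Qed.

Section Increment.
Variables (n : nat) (p f : cube n -> R).
Hypotheses (p_ge0 : forall x, 0 <= p x) (nr : negative_regression p)
  (lip : lipschitz1 f).
Variables (J : {set 'I_n}) (a : cube n) (i : 'I_n).

Let A (b : bool) : pred (cube n) := agree_on (i |: J) (set_coord a i b).
Let K : {set 'I_n} := ~: (i |: J).

Hypotheses (PA : forall b, 0 < Pr p (A b))
  (covered : CondExpect p (weight K) (A false) <= 1 + CondExpect p (weight K) (A true)).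

Let freeze (x : cube n) : cube n :=
  [ffun j => if j \in K then x j else set_coord a i false j].
Let f0 x := f (freeze x).

Lemma freeze_agree x : A false x -> freeze x = x.
Proof.
move=> /forall_inP Ax; apply/ffunP => j; rewrite ffunE inE.
by case: (boolP (j \in i |: J)) => //= /Ax /eqP ->.
Qed.

Lemma freeze_offcoord x : A true x -> forall j, j != i -> x j = freeze x j.
Proof.
move=> /forall_inP Ax j ji; rewrite ffunE inE.
case: (boolP (j \in i |: J)) => //= /Ax /eqP ->.
by rewrite !ffunE (negbTE ji).
Qed.

Lemma freeze_le x : A true x -> forall j, freeze x j ==> x j.
Proof.
move=> Ax j; case: (eqVneq j i) => [->|ji]; last by rewrite -freeze_offcoord // implybb.
by rewrite ffunE inE setU11 /= ffunE eqxx.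
Qed.

Lemma CondExpect_frozen : CondExpect p f0 (A false) = CondExpect p f (A false).
Proof. by apply: CondExpect_ext => x /freeze_agree; rewrite /f0 => ->. Qed.

Lemma negative_regression_step g :
  depends_only_on K g -> nondecreasing_on K g ->
  CondExpect p g (A true) <= CondExpect p g (A false).
Proof.
move=> dg mg; have KJ : [disjoint K & i |: J] by rewrite disjoints_subset.
apply/Rge_le/(nr KJ dg mg).
- by move=> j _; rewrite !ffunE; case: eqP => // _; apply: implybb.
- exact: PA.
- exact: PA.
Qed.

Lemma freeze_eq (x y : cube n) : (forall j, j \in K -> x j = y j) -> freeze x = freeze y.
Proof. by move=> xy; apply/ffunP => j; rewrite !ffunE; case: ifP => // /xy. Qed.

Lemma frozen_diff (x y : cube n) : (forall j, j \in K -> x j ==> y j) ->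
  Rabs (f0 x - f0 y) <= weight K y + -1 * weight K x.
Proof.
move=> xy; rewrite /weight -Rsum_scale -big_split /=.
rewrite (eq_bigr (fun j => ind (freeze y j) + -1 * ind (freeze x j))); last first.
  by move=> j jK; rewrite !ffunE jK.
rewrite -big_enum; apply: (@lipschitz_weight n f) => // j.
  by rewrite mem_enum !ffunE => /negbTE ->.
by rewrite !ffunE; case: ifP => [/xy //|_]; apply: implybb.
Qed.

Lemma CondExpect_frozen_diff :
  Rabs (CondExpect p f0 (A true) - CondExpect p f0 (A false)) <= 1.
Proof.
have nrs s : Rabs s = 1 ->
  CondExpect p (fun x => weight K x + s * f0 x) (A true) <=
  CondExpect p (fun x => weight K x + s * f0 x) (A false).
  move=> s1; apply: negative_regression_step => x y xy.
    rewrite /f0 (@freeze_eq x y) //; congr (_ + _).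
    by apply: eq_bigr => j /xy ->.
  have := frozen_diff xy.
  have := Rle_abs (s * (f0 x - f0 y)); rewrite Rabs_mult s1; lra.
have := nrs 1 (Rabs_R1).
have := nrs (-1) ltac:(by rewrite Rabs_left; lra).
rewrite !CondExpectD !CondExpectZ => n1 n2.
by apply: Rabs_le; move: covered n1 n2; rewrite /weight /=; lra.
Qed.

Lemma CondExpect_unfreeze :
  Rabs (CondExpect p f (A true) - CondExpect p f0 (A true)) <= 1.
Proof.
have fx x : A true x -> Rabs (f x - f0 x) <= 1.
  by move=> Ax; apply: (@lip i x (freeze x)) => j ji; apply: freeze_offcoord.
have le1 : CondExpect p f (A true) <= CondExpect p (fun x => f0 x + 1) (A true).
  by apply: CondExpect_le => // x /fx; have := Rle_abs (f x - f0 x); lra.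
have le2 : CondExpect p f0 (A true) <= CondExpect p (fun x => f x + 1) (A true).
  apply: CondExpect_le => // x /fx; rewrite Rabs_minus_sym.
  by have := Rle_abs (f0 x - f x); lra.
move: le1 le2; rewrite !CondExpectD !CondExpect_cst //.
by move=> ? ?; apply: Rabs_le; lra.
Qed.

Lemma increment_le2 :
  Rabs (CondExpect p f (A true) - CondExpect p f (A false)) <= 2.
Proof.
rewrite -CondExpect_frozen.
have /Rabs_le_between h1 := CondExpect_unfreeze.
have /Rabs_le_between h2 := CondExpect_frozen_diff.
by apply: Rabs_le; lra.
Qed.

Lemma increment_monotone_le1 : monotone f ->
  Rabs (CondExpect p f (A true) - CondExpect p f (A false)) <= 1.
Proof.
move=> mf; rewrite -CondExpect_frozen.
have /Rabs_le_between h1 := CondExpect_unfreeze.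
have /Rabs_le_between h2 := CondExpect_frozen_diff.
have h3 : CondExpect p f0 (A true) <= CondExpect p f0 (A false).
  apply: negative_regression_step => x y xy.
    by rewrite /f0 (@freeze_eq x y).
  by apply: mf => j; rewrite !ffunE; case: ifP => [/xy //|_]; apply: implybb.
have h4 : CondExpect p f0 (A true) <= CondExpect p f (A true).
  by apply: CondExpect_le => // x Ax; apply/mf/freeze_le.
by apply: Rabs_le; lra.
Qed.

End Increment.

Section Concentration.
Variables (n : nat) (p f : cube n -> R) (c : R).
Hypothesis p_ge0 : forall x, 0 <= p x.
Hypothesis increment : forall (J : {set 'I_n}) (a : cube n) (i : 'I_n),
  let A b := agree_on (i |: J) (set_coord a i b) in
  let K := ~: (i |: J) in
  (forall b, 0 < Pr p (A b)) ->
  CondExpect p (weight K) (A false) <= 1 + CondExpect p (weight K) (A true) ->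
  Rabs (CondExpect p f (A true) - CondExpect p f (A false)) <= c.

Lemma Pr_eq (A B : pred (cube n)) : A =1 B -> Pr p A = Pr p B.
Proof. exact: eq_bigl. Qed.

Lemma CondExpect_eq (A B : pred (cube n)) g : A =1 B ->
  CondExpect p g A = CondExpect p g B.
Proof.
by move=> AB; rewrite /CondExpect (Pr_eq AB); congr (_ / _); apply: eq_bigl.
Qed.

Lemma Pr_agree_split (J : {set 'I_n}) a i : i \notin J ->
  Pr p (agree_on J a) = Pr p (agree_on (i |: J) (set_coord a i false)) +
                        Pr p (agree_on (i |: J) (set_coord a i true)).
Proof.
move=> iJ; rewrite (Pr_split p (agree_on J a) (fun x => x i)).
by congr (_ + _); apply: Pr_eq => x; rewrite agree_on_set_coord //;
  case: (x i).
Qed.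

Lemma CondExpect_agree_split (J : {set 'I_n}) a i g : i \notin J ->
  let A b := agree_on (i |: J) (set_coord a i b) in
  Pr p (agree_on J a) * CondExpect p g (agree_on J a) =
  Pr p (A false) * CondExpect p g (A false) +
  Pr p (A true) * CondExpect p g (A true).
Proof.
move=> iJ A; rewrite (CondExpect_split p_ge0 (agree_on J a) (fun x => x i)).
have A0 : (fun x => agree_on J a x && ~~ x i) =1 A false.
  by move=> x; rewrite /A agree_on_set_coord //; case: (x i).
have A1 : (fun x => agree_on J a x && x i) =1 A true.
  by move=> x; rewrite /A agree_on_set_coord //; case: (x i).
by rewrite (Pr_eq A0) (Pr_eq A1) (CondExpect_eq g A0) (CondExpect_eq g A1).
Qed.

Lemma weight_setC_split (J : {set 'I_n}) i x : i \notin J ->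
  weight (~: J) x = ind (x i) + weight (~: (i |: J)) x.
Proof.
move=> iJ; rewrite /weight (bigD1 i) /=; last by rewrite inE.
by congr (_ + _); apply: eq_bigl => j; rewrite !inE negb_or andbC.
Qed.

Lemma covered_of_covariance (J : {set 'I_n}) a i : i \notin J ->
  let A b := agree_on (i |: J) (set_coord a i b) in
  let K := ~: (i |: J) in
  (forall b, 0 < Pr p (A b)) ->
  CondExpect p (fun x => ind (x i)) (agree_on J a) *
    CondExpect p (weight (~: J)) (agree_on J a) <=
  CondExpect p (fun x => ind (x i) * weight (~: J) x) (agree_on J a) ->
  CondExpect p (weight K) (A false) <= 1 + CondExpect p (weight K) (A true).
Proof.
move=> iJ A K PA cov.
have val b x : A b x -> x i = b.
  by rewrite /A agree_on_set_coord // => /andP[_ /eqP].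
have PE := Pr_agree_split a iJ.
have E1 := CondExpect_agree_split a (fun x => ind (x i)) iJ.
have E2 := CondExpect_agree_split a (weight (~: J)) iJ.
have E3 := CondExpect_agree_split a (fun x => ind (x i) * weight (~: J) x) iJ.
rewrite -/(A false) -/(A true) in PE; rewrite /= -/(A false) -/(A true) in E1 E2 E3.
have indE b : CondExpect p (fun x => ind (x i)) (A b) = ind b.
  rewrite -[RHS](CondExpect_cst (ind b) (PA b)).
  by apply: CondExpect_ext => x /val ->.
have weightE b : CondExpect p (weight (~: J)) (A b) = ind b + CondExpect p (weight K) (A b).
  rewrite -(CondExpect_cst (ind b) (PA b)) -CondExpectD.
  by apply: CondExpect_ext => x /val xi; rewrite (weight_setC_split x iJ) xi.
have prodE b : CondExpect p (fun x => ind (x i) * weight (~: J) x) (A b) =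
    ind b * (ind b + CondExpect p (weight K) (A b)).
  rewrite -weightE -CondExpectZ.
  by apply: CondExpect_ext => x /val ->.
rewrite !indE /ind in E1; rewrite !weightE /ind in E2; rewrite !prodE /ind in E3.
have P0 := PA false; have P1 := PA true.
move: cov PE E1 E2 E3 P0 P1.
move: (Pr p (agree_on J a)) (Pr p (A false)) (Pr p (A true)) => P P0 P1.
move: (CondExpect p (weight K) (A false)) (CondExpect p (weight K) (A true)) => s0 s1.
move: (CondExpect p (fun x => ind (x i)) _) (CondExpect p (weight (~: J)) _)
  (CondExpect p (fun x => ind (x i) * weight (~: J) x) _) => u v w cov PE E1 E2 E3 P0p P1p.
have h : (P * u) * (P * v) <= P * (P * w).
  have -> : (P * u) * (P * v) = (P * P) * (u * v) by ring.
  have -> : P * (P * w) = (P * P) * w by ring.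
  apply: Rmult_le_compat_l => //; nra.
rewrite E1 E2 E3 PE in h.
have : 0 <= (P0 * P1) * (1 + s1 - s0) by lra.
move=> h2; have PP : 0 < P0 * P1 by apply: Rmult_lt_0_compat.
case: (Rle_lt_dec s0 (1 + s1)) => // lt; nra.
Qed.

Lemma CondExpect_exp_le (l : R) (k : nat) (J : {set 'I_n}) (a : cube n) :
  #|~: J| = k -> 0 < Pr p (agree_on J a) ->
  CondExpect p (fun x => exp (l * (f x - CondExpect p f (agree_on J a)))) (agree_on J a)
  <= exp (INR k * ((l * c) ^ 2 / 8)).
Proof.
elim: k J a => [|k IH] J a cardJ PJ.
  have agree_eq x : agree_on J a x -> x = a.
    move=> /forall_inP xa; apply/ffunP => i; apply/eqP/xa.
    by have := card0_eq cardJ i; rewrite inE => /negbFE.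
  have -> : CondExpect p f (agree_on J a) = f a.
    rewrite -[RHS](CondExpect_cst (f a) PJ).
    by apply: CondExpect_ext => x /agree_eq ->.
  rewrite (@CondExpect_ext _ _ _ _ (fun=> 1)); last first.
    by move=> x /agree_eq ->; rewrite Rminus_diag Rmult_0_r exp_0.
  by rewrite CondExpect_cst // /= Rmult_0_l exp_0; apply: Rle_refl.
have [|i] := @exists_nonneg_covariance n p (agree_on J a) (~: J) p_ge0 PJ.
  by rewrite -card_gt0 cardJ.
rewrite inE => iJ cov.
pose A b := agree_on (i |: J) (set_coord a i b).
have cardK : #|~: (i |: J)| = k.
  by have := cardJ; rewrite (cardsD1 i) inE iJ => -[<-]; rewrite setCU setIC setDE.
set m := CondExpect p f (agree_on J a).
have PE := Pr_agree_split a iJ.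
have Em := CondExpect_agree_split a f iJ.
have Ee := CondExpect_agree_split a (fun x => exp (l * (f x - m))) iJ.
rewrite -/(A false) -/(A true) in PE; rewrite /= -/(A false) -/(A true) in Em Ee.
have IHb b := IH (i |: J) (set_coord a i b) cardK.
rewrite -/m in Em.
pose E := exp (INR k * ((l * c) ^ 2 / 8)).
have E_pos : 0 < E by apply: exp_pos.
have c2 : 0 <= (l * c) ^ 2 / 8 by have := pow2_ge_0 (l * c); lra.
have -> : exp (INR k.+1 * ((l * c) ^ 2 / 8)) = exp ((l * c) ^ 2 / 8) * E.
  by rewrite -exp_plus S_INR; congr exp; ring.
have E1 : 1 <= exp ((l * c) ^ 2 / 8) by rewrite -exp_0; apply: exp_le_compat.
have branch b : 0 < Pr p (A b) ->
  CondExpect p (fun x => exp (l * (f x - m))) (A b) <=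
  exp (l * (CondExpect p f (A b) - m)) * E.
  move=> Pb; have := IHb b Pb; rewrite -/(A b) -/E => le.
  rewrite (@CondExpect_ext _ _ _ _ (fun x =>
    exp (l * (CondExpect p f (A b) - m)) * exp (l * (f x - CondExpect p f (A b))))).
    by rewrite CondExpectZ; apply: Rmult_le_compat_l => //; apply/Rlt_le/exp_pos.
  by move=> x _; rewrite -exp_plus; congr exp; ring.
have degenerate b : Pr p (A (~~ b)) = 0 ->
  CondExpect p (fun x => exp (l * (f x - m))) (agree_on J a) <=
  exp ((l * c) ^ 2 / 8) * E.
  move=> Pb0.
  have Pb : Pr p (A b) = Pr p (agree_on J a) by case: b Pb0 => /= ?; lra.
  have only_b g : CondExpect p g (agree_on J a) = CondExpect p g (A b).
    apply: (Rmult_eq_reg_l (Pr p (agree_on J a))); last lra.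
    rewrite (CondExpect_agree_split a g iJ) /= -/(A false) -/(A true).
    by rewrite -Pb; case: b Pb0 {Pb} => /= ->; ring.
  have := branch b; rewrite Pb -(only_b f) -/m Rminus_diag Rmult_0_r exp_0 => /(_ PJ).
  rewrite -only_b => le; apply: Rle_trans le _.
  by apply: Rmult_le_compat_r => //; lra.
case: (Rle_lt_or_eq_dec _ _ (Pr_ge0 p_ge0 (A false))) => [P0|/esym P0]; last first.
  exact: (degenerate true).
case: (Rle_lt_or_eq_dec _ _ (Pr_ge0 p_ge0 (A true))) => [P1|/esym P1]; last first.
  exact: (degenerate false).
have PA b : 0 < Pr p (A b) by case: b.
have inc := increment PA (covered_of_covariance iJ PA cov).
have b0 := branch false P0; have b1 := branch true P1.
rewrite -/(A false) -/(A true) in inc.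
move: Em Ee PE PJ P0 P1 b0 b1 inc; clear - E_pos c2.
move: (Pr p (agree_on J a)) (Pr p (A false)) (Pr p (A true)) => P P0 P1.
move: (CondExpect p f (A false)) (CondExpect p f (A true)) => m0 m1.
move: (CondExpect p _ (A false)) (CondExpect p _ (A true))
  (CondExpect p _ (agree_on J a)) => e0 e1 e Em Ee PE PJ P0p P1p b0 b1 inc.
pose q := P1 / P.
have q1 : 1 - q = P0 / P by rewrite /q PE; field; lra.
have q0 : 0 < q by apply: Rdiv_lt_0_compat.
have q1p : 0 < 1 - q by rewrite q1; apply: Rdiv_lt_0_compat.
have mE : m = m0 + q * (m1 - m0).
  apply: (Rmult_eq_reg_l P); last lra.
  by rewrite Em /q PE; field; lra.
have eE : e = (1 - q) * e0 + q * e1.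
  apply: (Rmult_eq_reg_l P); last lra.
  by rewrite Ee q1 /q; field; lra.
have hoef := @hoeffding_two_point q (l * (m1 - m0)) ltac:(lra).
have s0 : l * (m0 - m) = - (q * (l * (m1 - m0))) by rewrite mE; ring.
have s1 : l * (m1 - m) = (1 - q) * (l * (m1 - m0)) by rewrite mE; ring.
rewrite s0 in b0; rewrite s1 in b1.
have sq : (l * (m1 - m0)) ^ 2 / 8 <= (l * c) ^ 2 / 8.
  rewrite !Rpow_mult_distr -(pow2_abs (m1 - m0)).
  have := pow2_ge_0 l; have := Rabs_pos (m1 - m0) => a0 l0.
  have : Rabs (m1 - m0) ^ 2 <= c ^ 2 by apply: pow_incr.
  by move=> le; have := Rmult_le_compat_l _ _ _ l0 le; lra.
have {}hoef := Rle_trans _ _ _ hoef (exp_le_compat sq).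
rewrite eE.
apply: Rle_trans (Rmult_le_compat_r E _ _ (Rlt_le _ _ E_pos) hoef).
have := Rmult_le_compat_l _ _ _ (Rlt_le _ _ q1p) b0.
have := Rmult_le_compat_l _ _ _ (Rlt_le _ _ q0) b1.
lra.
Qed.

Hypothesis p_total : \big[Rplus/0]_(x : cube n) p x = 1.

Lemma agree_on_set0 (a : cube n) : agree_on set0 a =1 xpredT.
Proof. by move=> x; apply/forall_inP => i; rewrite inE. Qed.

Lemma CondExpect_true g : CondExpect p g xpredT = Expect p g.
Proof.
by rewrite /CondExpect /Pr p_total /Rdiv Rinv_1 Rmult_1_r.
Qed.

Lemma Expect_exp_le (l : R) :
  Expect p (fun x => exp (l * (f x - Expect p f))) <= exp (INR n * ((l * c) ^ 2 / 8)).
Proof.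
pose a : cube n := [ffun=> false].
have T := agree_on_set0 a.
have := @CondExpect_exp_le l n set0 a.
rewrite setC0 cardsT card_ord (Pr_eq T) !(CondExpect_eq _ T) !CondExpect_true.
by apply=> //; rewrite /Pr p_total; lra.
Qed.

Lemma Pr_le_chernoff (A : pred (cube n)) (l t : R) :
  (forall x, A x -> l * t <= l * (f x - Expect p f)) ->
  Pr p A <= exp (INR n * ((l * c) ^ 2 / 8) - l * t).
Proof.
move=> Alt; rewrite /Rminus exp_plus Rmult_comm.
have le : Pr p A <= \big[Rplus/0]_(x : cube n)
    (exp (- (l * t)) * (p x * exp (l * (f x - Expect p f)))).
  rewrite /Pr big_mkcond /=; apply: Rsum_le => x _.
  have e1 := exp_pos (- (l * t)); have e2 := exp_pos (l * (f x - Expect p f)).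
  case: ifP => [/Alt le|_]; last first.
    by apply: Rmult_le_pos; [lra | apply: Rmult_le_pos => //; lra].
  have : 1 <= exp (- (l * t)) * exp (l * (f x - Expect p f)).
    by rewrite -exp_plus -exp_0; apply: exp_le_compat; lra.
  by move/(Rmult_le_compat_l _ _ _ (p_ge0 x)); lra.
apply: Rle_trans le _; rewrite Rsum_scale; apply: Rmult_le_compat_l.
  exact/Rlt_le/exp_pos.
exact: Expect_exp_le.
Qed.

Lemma Pr_le1 (A : pred (cube n)) : Pr p A <= 1.
Proof.
rewrite -p_total /Pr big_mkcond /=; apply: Rsum_le => x _.
by case: ifP => _; [apply: Rle_refl | apply: p_ge0].
Qed.

Hypothesis c_pos : 0 < c.

(* For [n = 0] the exponent is [_ / 0 = 0] and the bound is the trivial one. *)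
Lemma Pr_tail_le (s t : R) (A : pred (cube n)) : s ^ 2 = 1 ->
  (forall x, A x -> t <= s * (f x - Expect p f)) -> 0 < t ->
  Pr p A <= exp (- (2 * t ^ 2) / (c ^ 2 * INR n)).
Proof.
move=> s1 At t0; case: (posnP n) => [n0|/ltP/lt_0_INR n0].
  have -> : INR n = 0 by rewrite n0.
  rewrite Rmult_0_r /Rdiv Rinv_0 Rmult_0_r exp_0; exact: Pr_le1.
pose k := 4 * t / (c ^ 2 * INR n).
have cn : 0 < c ^ 2 * INR n by apply: Rmult_lt_0_compat => //; apply: pow_lt.
have k0 : 0 < k by apply: Rdiv_lt_0_compat; lra.
have := @Pr_le_chernoff A (s * k) (s * t).
have -> : INR n * ((s * k * c) ^ 2 / 8) - s * k * (s * t) = - (2 * t ^ 2) / (c ^ 2 * INR n).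
  have -> : INR n * ((s * k * c) ^ 2 / 8) - s * k * (s * t) =
    s ^ 2 * (INR n * (k * c) ^ 2 / 8 - k * t) by field.
  by rewrite s1 /k; field; split; lra.
apply=> x /At le.
have -> : s * k * (s * t) = k * (s ^ 2 * t) by ring.
have -> : s * k * (f x - Expect p f) = k * (s * (f x - Expect p f)) by ring.
by rewrite s1 Rmult_1_l; apply: Rmult_le_compat_l => //; lra.
Qed.

Lemma Pr_both_tails_le (t : R) : 0 < t ->
  Pr p (fun x => Rleb (Expect p f + t) (f x)) <= exp (- (2 * t ^ 2) / (c ^ 2 * INR n)) /\
  Pr p (fun x => Rleb (f x) (Expect p f - t)) <= exp (- (2 * t ^ 2) / (c ^ 2 * INR n)).
Proof.
move=> t0; split.
- apply: (@Pr_tail_le 1) => // [|x]; first lra.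
  by rewrite /Rleb; case: Rle_dec => // le _; lra.
- apply: (@Pr_tail_le (-1)) => // [|x]; first lra.
  by rewrite /Rleb; case: Rle_dec => // le _; lra.
Qed.

End Concentration.

Theorem mainTheorem1 (n : nat) (p : cube n -> R) (f : cube n -> R) (t : R) :
  is_distribution p -> negative_regression p -> lipschitz1 f -> 0 < t ->
  let mu := Expect p f in
  Pr p (fun x => Rleb (mu + t) (f x)) <= exp (- t ^ 2 / (2 * INR n)) /\
  Pr p (fun x => Rleb (f x) (mu - t)) <= exp (- t ^ 2 / (2 * INR n)) /\
  (monotone f ->
     Pr p (fun x => Rleb (mu + t) (f x)) <= exp (- (2 * t ^ 2) / INR n) /\
     Pr p (fun x => Rleb (f x) (mu - t)) <= exp (- (2 * t ^ 2) / INR n)).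
Proof.
move=> [p0 p1] nr lip t0 mu.
have [up lo] := Pr_both_tails_le p0 (increment_le2 p0 nr lip) p1 ltac:(lra) t0.
have <- : - (2 * t ^ 2) / (2 ^ 2 * INR n) = - t ^ 2 / (2 * INR n).
  by rewrite /Rdiv !Rinv_mult; move: (/ INR n) => v; field.
split=> //; split=> // mf.
have inc1 J a i PA cov := @increment_monotone_le1 n p f p0 nr lip J a i PA cov mf.
have := Pr_both_tails_le p0 inc1 p1 ltac:(lra) t0.
by rewrite pow1 Rmult_1_l.
Qed.
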